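(* For any Kripke model $\mathcal{M}$ and any formula $\varphi\in\mathcal{L}$, the model $\mathcal{M}^{\div\varphi}$ obtained by contracting on $\varphi$ is isomorphic to the generalized product update $\mathcal{M}\otimes\mathcal{E}(\div\varphi)$ of $\mathcal{M}$ with the event model $\mathcal{E}(\div\varphi)$ for contraction on $\varphi$.
   Context: Language and models. $At$ is a countable set of atoms, $Ag$ a finite set of agents. The doxastic language $\mathcal{L}$ is given by $\varphi::=\top\mid p\mid\neg\varphi\mid\varphi\wedge\varphi\mid B_a\varphi$ with $p\in At$, $a\in Ag$. A Kripke model is $\mathcal{M}=(W,R,V)$ with $W\neq\emptyset$, $R_a\subseteq W\times W$ arbitrary for each $a\in Ag$, $V:At\to\wp(W)$; $R_a(w)=\{v:(w,v)\in R_a\}$; $\mathcal{M},w\vDash B_a\varphi$ iff $\mathcal{M},v\vDash\varphi$ for all $v\in R_a(w)$; other clauses standard. $\varphi\vDash\psi$ means that every world of every Kripke model satisfying $\varphi$ satisfies $\psi$. An isomorphism of Kripke models is a bijection between their worlds that preserves and reflects each accessibility relation and the valuation of every atom. An empty conjunction is $\top$. Contraction. $\mathcal{M}^{\div\varphi}=(W,R^{\div\varphi},V)$ with $R_a^{\div\varphi}(w)=R_a(w)\cup\{v\in W:\mathcal{M},v\vDash\neg\varphi\}$ if $\mathcal{M},w\vDash B_a\varphi$, and $R_a^{\div\varphi}(w)=R_a(w)$ otherwise. Generalized event models. A generalized event model is $\mathcal{E}=(E,Q,Q^+,pre)$ with $E$ a non-empty finite set of events, $Q_a,Q_a^+\subseteq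 E\times E$ for each $a\in Ag$, and $pre$ a function assigning to each event a formula (here, formulas of $\mathcal{L}$ suffice); $Q_a(e)=\{f:(e,f)\in Q_a\}$, $Q_a^+(e)=\{f:(e,f)\in Q_a^+\}$. The generalized product update is $\mathcal{M}\otimes\mathcal{E}=(W^{\mathcal E},R^{\mathcal E},V^{\mathcal E})$ with $W^{\mathcal E}=\{(w,e)\in W\times E:\mathcal{M},w\vDash pre(e)\}$; for $(w,e),(v,f)\in W^{\mathcal E}$, $(v,f)\in R_a^{\mathcal E}(w,e)$ iff either $f\in Q_a^+(e)$, or $v\in R_a(w)$ and $f\in Q_a(e)$; $V^{\mathcal E}(p)=\{(w,e)\in W^{\mathcal E}:w\in V(p)\}$. Event model for contraction on $\varphi$. $\mathcal{E}(\div\varphi)=(E,Q,Q^+,pre)$ where: (1) $E=\{\varphi\wedge\bigwedge_{a\in A}\neg B_a\varphi\wedge\bigwedge_{a\in Ag\setminus A}B_a\varphi:A\subseteq Ag\}\cup\{\neg\varphi\wedge\bigwedge_{a\in A}\neg B_a\varphi\wedge\bigwedge_{a\in Ag\setminus A}B_a\varphi:A\subseteq Ag\}$; (2) for all $a\in Ag$, $e\in E$: $Q_a(e)=E$, and $Q_a^+(e)=\{f\in E:pre(f)\vDash\neg\varphi\}$ if $pre(e)\vDash B_a\varphi$, and $Q_a^+(e)=\emptyset$ otherwise; (3) $pre(e)=e$ for all $e\in E$. *)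

(* Defs.v *)
From HB Require Import structures.
From mathcomp Require Import all_boot.

Set Implicit Arguments.
Unset Strict Implicit.
Unset Printing Implicit Defensive.

Inductive form (At Ag : Type) : Type :=
| Top
| Atom of At
| Neg of form At Ag
| And of form At Ag & form At Ag
| Bel of Ag & form At Ag.

Arguments Top {At Ag}.
Arguments Atom {At Ag} p.

(* Formulas form a countType: events of the contraction model are formulas,
   and a finite set of events is carved out of [form At Ag]. *)
Section FormCountable.
Variables At Ag : Type.

Fixpoint form_encode (phi : form At Ag) : GenTree.tree (At + Ag) :=
  match phi with
  | Top => GenTree.Node 0 [::]
  | Atom p => GenTree.Leaf (inl p)
  | Neg psi => GenTree.Node 1 [:: form_encode psi]
  | And psi chi => GenTree.Node 2 [:: form_encode psi; form_encode chi]
  | Bel a psi => GenTree.Node 3 [:: GenTree.Leaf (inr a); form_encode psi]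
  end.

Fixpoint form_decode (t : GenTree.tree (At + Ag)) : option (form At Ag) :=
  match t with
  | GenTree.Node 0 [::] => Some Top
  | GenTree.Leaf (inl p) => Some (Atom p)
  | GenTree.Node 1 [:: t1] => omap (@Neg At Ag) (form_decode t1)
  | GenTree.Node 2 [:: t1; t2] =>
      if (form_decode t1, form_decode t2) is (Some psi, Some chi)
      then Some (And psi chi) else None
  | GenTree.Node 3 [:: GenTree.Leaf (inr a); t1] =>
      omap (Bel a) (form_decode t1)
  | _ => None
  end.

Lemma form_encodeK : pcancel form_encode form_decode.
Proof.
by elim=> //= [phi -> | phi -> psi -> | a phi ->].
Qed.

End FormCountable.

HB.instance Definition _ (At Ag : countType) :=
  Countable.copy (form At Ag) (pcan_type (@form_encodeK At Ag)).

(* A relational structure may have no world: in general, a product update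
   need not be a Kripke model since every precondition may fail everywhere. *)
Record structure (At Ag : Type) : Type := Structure {
  world :> Type;
  acc : Ag -> world -> world -> Prop;
  val_at : At -> world -> Prop
}.

Record kripke_model (At Ag : Type) : Type := KripkeModel {
  kripke_structure :> structure At Ag;
  kripke_nonempty : inhabited kripke_structure
}.

Fixpoint sat (At Ag : Type) (M : structure At Ag) (w : M)
    (phi : form At Ag) : Prop :=
  match phi with
  | Top => True
  | Atom p => val_at p w
  | Neg psi => ~ sat w psi
  | And psi chi => sat w psi /\ sat w chi
  | Bel a psi => forall v : M, acc a w v -> sat v psi
  end.

Definition entails (At Ag : Type) (phi psi : form At Ag) : Prop :=
  forall (M : kripke_model At Ag) (w : M), sat w phi -> sat w psi.

Definition isomorphic (At Ag : Type) (M N : structure At Ag) : Prop :=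
  exists f : M -> N,
    [/\ bijective f,
        forall (a : Ag) (w v : M), acc a w v <-> acc a (f w) (f v)
      & forall (p : At) (w : M), val_at p w <-> val_at p (f w)].

Definition contraction (At Ag : Type) (M : kripke_model At Ag)
    (phi : form At Ag) : kripke_model At Ag :=
  @KripkeModel At Ag
    (@Structure At Ag M
       (fun a w v => acc a w v \/ (sat w (Bel a phi) /\ sat v (Neg phi)))
       (fun p w => val_at p w))
    (kripke_nonempty M).

Record event_model (At Ag : Type) : Type := EventModel {
  event :> finType;
  event_nonempty : inhabited event;
  evQ : Ag -> event -> event -> Prop;
  evQplus : Ag -> event -> event -> Prop;
  pre : event -> form At Ag
}.

Definition product_update (At Ag : Type) (M : kripke_model At Ag)
    (E : event_model At Ag) : structure At Ag :=
  @Structure At Ag {we : M * E | sat we.1 (pre we.2)}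
    (fun a x y => evQplus a (sval x).2 (sval y).2 \/
       (acc a (sval x).1 (sval y).1 /\ evQ a (sval x).2 (sval y).2))
    (fun p x => val_at p (sval x).1).

Section ContractionEvents.
Variables (At : countType) (Ag : finType).

(* [lit] is [phi] or [Neg phi]. *)
Definition contraction_event (phi lit : form At Ag) (A : {set Ag})
    : form At Ag :=
  And lit (And (\big[@And At Ag/Top]_(a in A) Neg (Bel a phi))
               (\big[@And At Ag/Top]_(a in ~: A) Bel a phi)).

Definition contraction_events (phi : form At Ag) : seq (form At Ag) :=
  [seq contraction_event phi phi A | A : {set Ag}] ++
  [seq contraction_event phi (Neg phi) A | A : {set Ag}].

Lemma contraction_events_nonempty (phi : form At Ag) :
  inhabited (seq_sub (contraction_events phi)).
Proof.
suff h : contraction_event phi phi set0 \in contraction_events phi.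
  by exact: inhabits (SeqSub h).
by rewrite mem_cat map_f // mem_enum.
Qed.

(* [seq_sub s] is the finite type of the elements of [s] without repetition,
   so that events are formulas, up to equality of formulas. *)
Definition contraction_event_model (phi : form At Ag) : event_model At Ag :=
  @EventModel At Ag (seq_sub (contraction_events phi))
    (contraction_events_nonempty phi)
    (fun _ _ _ => True)
    (fun a e f => entails (ssval e) (Bel a phi) /\ entails (ssval f) (Neg phi))
    (fun e => ssval e).

End ContractionEvents.

(* Main.v *)
(* Every world satisfies exactly one event of the contraction model: the one
   whose literal is the true one among [phi], [Neg phi], and whose set [A]
   collects the agents not believing [phi].  Sending a world to itself paired
   with this event inverts the first projection.  An event decides each of
   [Bel a phi] and [Neg phi], so entailment by the event of a world is the same
   as truth at that world. *)
Require Import Defs.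
From mathcomp Require Import all_boot.
From mathcomp Require Import boolp.

Set Implicit Arguments.
Unset Strict Implicit.
Unset Printing Implicit Defensive.

(** The fold over [r] needs no equality on [I] and lends itself to induction on the list. *)
Lemma sat_bigAnd (At Ag I : Type) (M : structure At Ag) (w : M) (r : seq I)
    (P : pred I) (F : I -> form At Ag) :
  sat w (\big[@And At Ag/Top]_(i <- r | P i) F i) <->
  foldr (fun i Q => (P i -> sat w (F i)) /\ Q) True r.
Proof.
elim: r => [|i r IHr]; first by rewrite big_nil.
rewrite big_cons /=; case: (P i) => /=; rewrite IHr; last by split=> [|[]].
by split=> -[Fi Qr]; split=> //; exact: Fi.
Qed.

Lemma sat_bigAnd_in (At Ag : Type) (I : finType)
    (M : structure At Ag) (w : M) (A : {set I}) (F : I -> form At Ag) :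
  sat w (\big[@And At Ag/Top]_(i in A) F i) <->
  forall i, i \in A -> sat w (F i).
Proof.
rewrite sat_bigAnd; split=> [+ i Ai | FA]; last first.
  by elim: (index_enum I) => //= i r IHr; split=> // Ai; exact: FA.
(* Membership of [i] in the enumeration is kept as a premise, so that the induction runs over
   arbitrary lists. *)
have := mem_index_enum i; elim: (index_enum I) => //= j r IHr.
by rewrite inE => /predU1P[<- [/(_ Ai)] | /IHr + [_]].
Qed.

Section ContractionEventTheory.
Variables (At : countType) (Ag : finType).
Implicit Types (phi psi e : form At Ag) (A : {set Ag}).

Definition nonbelievers (M : structure At Ag) (w : M) phi : {set Ag} :=
  [set a | `[< ~ sat w (Bel a phi) >]].

Definition true_literal (M : structure At Ag) (w : M) phi : form At Ag :=
  if `[< sat w phi >] then phi else Neg phi.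

Definition event_of (M : structure At Ag) (w : M) phi : form At Ag :=
  contraction_event phi (true_literal w phi) (nonbelievers w phi).

(** The first conjunction places [A] inside the set of nonbelievers, the second makes every agent
    outside [A] a believer; together they determine [A]. *)
Lemma sat_contraction_event (M : structure At Ag) (w : M) phi psi A :
  sat w (contraction_event phi psi A) <-> sat w psi /\ A = nonbelievers w phi.
Proof.
rewrite [sat _ _]/=; split=> [[wpsi []] | [wpsi ->]].
  rewrite !sat_bigAnd_in => nB B; split=> //; apply/setP=> a; rewrite inE.
  case: (boolP (a \in A)) => Aa; apply/esym; first exact/asboolP/nB.
  by apply/asboolP; apply; apply: B; rewrite inE.
split=> //; split; apply/sat_bigAnd_in => a; rewrite !inE.
  by move/asboolP.
by move/asboolPn/contrapT.
Qed.

Lemma event_of_mem (M : structure At Ag) (w : M) phi :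
  event_of w phi \in contraction_events phi.
Proof.
rewrite mem_cat /event_of /true_literal.
by case: ifP => _; rewrite map_f ?mem_enum ?orbT.
Qed.

Lemma sat_event_of (M : structure At Ag) (w : M) phi : sat w (event_of w phi).
Proof.
apply/sat_contraction_event; split=> //.
by rewrite /true_literal; case: asboolP.
Qed.

Lemma contraction_event_unique (M : structure At Ag) (w : M) phi e :
  e \in contraction_events phi -> sat w e -> e = event_of w phi.
Proof.
by rewrite mem_cat => /orP[] /mapP[A _ ->] /sat_contraction_event[w_lit ->];
  rewrite /event_of /true_literal; case: asboolP.
Qed.

(** Left to right, entailment is applied at [w] itself. Conversely, any world satisfying the event
    of [w] has the same nonbelievers as [w]. *)
Lemma entails_event_of_Bel (M : kripke_model At Ag) (w : M) phi a :
  entails (event_of w phi) (Bel a phi) <-> sat w (Bel a phi).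
Proof.
split=> [|Bw N v]; first by apply; exact: sat_event_of.
move=> /sat_contraction_event[_ /setP/(_ a)]; rewrite !inE.
have /asboolPn/negbTE -> : ~ ~ sat w (Bel a phi) by apply.
by move/esym/negbT/asboolPn/contrapT.
Qed.

Lemma entails_event_of_Neg (M : kripke_model At Ag) (w : M) phi :
  entails (event_of w phi) (Neg phi) <-> sat w (Neg phi).
Proof.
split=> [|nw N v]; first by apply; exact: sat_event_of.
by move=> /sat_contraction_event[+ _]; rewrite /true_literal; case: asboolP.
Qed.

End ContractionEventTheory.

Theorem proposition7p4 (At : countType) (Ag : finType)
    (M : kripke_model At Ag) (phi : form At Ag) :
  isomorphic (contraction M phi)
    (product_update M (contraction_event_model phi)).
Proof.
pose E := contraction_event_model phi.
pose ev (w : M) : E := SeqSub (event_of_mem w phi).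
pose f (w : M) : product_update M E :=
  exist (fun we : M * E => sat we.1 (pre we.2)) (w, ev w) (sat_event_of w phi).
exists f; split=> [|a w v|//].
- exists (fun x => (sval x).1) => [//|[[w e] we]].
  (* Proof irrelevance leaves an equality of events, that is, of formulas; it holds because [w]
     satisfies [e]. *)
  apply: eq_exist => /=; congr pair; apply: val_inj => /=.
  by rewrite -(contraction_event_unique (valP e) we).
(* Both sides become the same two disjuncts in opposite order, as [evQ] always holds. *)
- rewrite /= entails_event_of_Bel entails_event_of_Neg /=.
  by split=> [[wv|B]|[B|[wv _]]]; [right|left|right|left].
Qed.
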